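(* Let $r\ge 2$ and $0\le s\le r-1$ be integers, $\mathbf{a}=(a_1,\ldots,a_r)\in\mathbb{C}^r$, $\mathbf{b}=(b_1,\ldots,b_s)\in\mathbb{C}^s$, $\mathbf{m}=(m_1,\ldots,m_s)\in\mathbb{Z}^s$, $\mathbf{n}=(n_1,\ldots,n_r)\in\mathbb{Z}^r$. Put $M=m_1+\cdots+m_s$, $N=n_1+\cdots+n_r$, $m_{\min}=\min_{1\le i\le s}m_i$, $n_{\max}=\max_{1\le i\le r}n_i$ and $$p=\left[\frac{M-N-r+1}{r-s}\right],$$ where $[x]$ is the largest integer not exceeding $x$. Assume that the components of $\mathbf{a}$ are distinct modulo integers, i.e. $a_i-a_j\notin\mathbb{Z}$ for $i\neq j$ (and that all factors in the formula below are defined). Then there exist complex numbers $\beta_j$, independent of $z$, such that for all complex $z\ne 0$ $$ \sum_{i=1}^{r}\frac{(1-\mathbf{b}+a_i)_{\mathbf{m}-n_i}\,z^{-n_i}}{(-1)^{(s-r)n_i}(a_i-\mathbf{a}_{[i]})_{\mathbf{n}_{[i]}-n_i+1}}\; {}_{s}F_{r-1}\!\left(\begin{matrix}\mathbf{b}-a_i\\ 1+\mathbf{a}_{[i]}-a_i\end{matrix}\,\Big|\, z\right) {}_{s}F_{r-1}\!\left(\begin{matrix}1-\mathbf{b}+a_i+\mathbf{m}-n_i\\ 1-\mathbf{a}_{[i]}+a_i+\mathbf{n}_{[i]}-n_i\end{matrix}\,\Big|\, (-1)^{r-s}z\right) =\sum_{j=-n_{\max}}^{\max(-m_{\min}-1,\,p)}\beta_j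 z^{j}, $$ where the sum on the right is $0$ if it is empty.
   Context: Rising factorial: for $k\in\mathbb{Z}$, $(z)_k=\Gamma(z+k)/\Gamma(z)$ as a rational function of $z$, i.e. $(z)_k=z(z+1)\cdots(z+k-1)$ for $k\ge 0$ (with $(z)_0=1$) and $(z)_k=\frac{1}{(z-1)(z-2)\cdots(z-|k|)}$ for $k<0$. Vector notation: scalars are added to vectors componentwise, e.g. $\mathbf{m}-n_i=(m_1-n_i,\ldots,m_s-n_i)$. For vectors of equal length, $(\mathbf{c})_{\mathbf{k}}=\prod_l (c_l)_{k_l}$ (equal to $1$ for empty vectors). The symbol $\mathbf{a}_{[j]}$ denotes $\mathbf{a}$ with the $j$-th component omitted. Thus $(1-\mathbf{b}+a_i)_{\mathbf{m}-n_i}=\prod_{l=1}^{s}(1-b_l+a_i)_{m_l-n_i}$ and $(a_i-\mathbf{a}_{[i]})_{\mathbf{n}_{[i]}-n_i+1}=\prod_{l\neq i}(a_i-a_l)_{n_l-n_i+1}$. Generalized hypergeometric function: for $\mathbf{c}\in\mathbb{C}^{s}$, $\mathbf{d}\in\mathbb{C}^{q}$ with no component of $\mathbf{d}$ a nonpositive integer, $${}_{s}F_{q}\!\left(\begin{matrix}\mathbf{c}\\ \mathbf{d}\end{matrix}\,\Big|\,z\right)=\sum_{k=0}^{\infty}\frac{(c_1)_k\cdots(c_s)_k}{(d_1)_k\cdots(d_q)_k}\frac{z^k}{k!},$$ which converges for all $z\in\mathbb{C}$ when $s\le q$. In the formula the upper parameters of the first function are $b_l-a_i$ ($1\le l\le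 s$) and the lower ones $1+a_l-a_i$ ($l\ne i$); the upper parameters of the second are $1-b_l+a_i+m_l-n_i$ ($1\le l\le s$) and the lower ones $1-a_l+a_i+n_l-n_i$ ($l\ne i$). When $s=0$ the vectors $\mathbf{b},\mathbf{m}$ are empty, $M=0$, and the minimum over the empty set is $m_{\min}=+\infty$, so that $\max(-m_{\min}-1,p)=p$. ''All factors are defined'' means that for each $i,l$ the factor $(1-b_l+a_i)_{m_l-n_i}$ is defined, i.e. if $m_l<n_i$ then $1-b_l+a_i\notin\{1,2,\ldots,n_i-m_l\}$. *)

(* Defs.v *)
From mathcomp Require Import all_boot all_order all_algebra.
From mathcomp Require Import complex.
From mathcomp Require Import all_classical all_reals all_analysis.

Set Implicit Arguments.
Unset Strict Implicit.
Unset Printing Implicit Defensive.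

Import Order.TTheory GRing.Theory Num.Theory.
Import numFieldNormedType.Exports.

Local Open Scope ring_scope.

(* The value is the mathematical one only when no denominator vanishes: the
   library sets 0^-1 = 0. *)
Definition rising (C : numFieldType) (z : C) (k : int) : C :=
  match k with
  | Posz n => \prod_(0 <= j < n) (z + j%:R)
  | Negz n => (\prod_(1 <= j < n.+2) (z - j%:R))^-1
  end.

Definition rising_vec (C : numFieldType) (s : nat)
    (c : 'I_s -> C) (k : 'I_s -> int) : C :=
  \prod_(l < s) rising (c l) (k l).

Definition omit (T : Type) (r : nat) (i : 'I_r) (v : 'I_r -> T) :
    'I_r.-1 -> T :=
  fun l => v (lift i l).

Definition hyp_term (C : numFieldType) (s q : nat)
    (c : 'I_s -> C) (d : 'I_q -> C) (z : C) (k : nat) : C :=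
  rising_vec c (fun=> k%:Z) / rising_vec d (fun=> k%:Z) * (z ^+ k / k`!%:R).

(* The limit, in the norm topology of C, of the partial sums; as usual for
   [lim], it is meaningful only when the series converges. *)
Definition hypF (C : numFieldType) (s q : nat)
    (c : 'I_s -> C) (d : 'I_q -> C) (z : C) : C :=
  limn (series (hyp_term c d z)).

(* Extrema are taken in the extended integers, where the minimum of an empty
   family is +oo. *)
Definition vec_min (s : nat) (m : 'I_s -> int) : \bar int :=
  \big[Order.min/+oo%E]_(l < s) (m l)%:E.

Definition vec_max (r : nat) (n : 'I_r -> int) : \bar int :=
  \big[Order.max/-oo%E]_(l < r) (n l)%:E.

(* max (- m_min - 1, p); it is p when s = 0, since then - m_min - 1 = -oo.
   The maximum is always finite, so [fine] loses nothing. *)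
Definition upper_index (s : nat) (m : 'I_s -> int) (p : int) : int :=
  fine (Order.max (- vec_min m - 1) p%:E)%E.

(* The increasing list of the integers j with lo <= j <= hi. *)
Definition int_range (lo hi : int) : seq int :=
  if lo <= hi then [seq lo + k%:Z | k <- iota 0 `|hi - lo|.+1] else [::].

(* Main.v *)
Require Import Defs.
From mathcomp Require Import all_boot all_order all_algebra.
From mathcomp Require Import complex zify ring.
From mathcomp Require Import all_classical all_reals all_analysis.

Set Implicit Arguments.
Unset Strict Implicit.
Unset Printing Implicit Defensive.

Import Order.TTheory GRing.Theory Num.Theory.
Import numFieldNormedType.Exports.

Local Open Scope ring_scope.

(** Both series are entire in z, so the left-hand side is a Laurent series that
    converges for every z <> 0, and its coefficients can be computed by the
    Cauchy product.  In the coefficient of z^j, the i-th summand contributes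
    the products of the k-th term of the first series and the l-th term of the
    second one, over all k + l = j + n_i.  The rising factorials of such a
    product merge (lemma [rising_merge]), and what remains is, up to the common
    sign (-1)^((r-s)j), the residue at t = a_i - k of the rational function
<<
      f_j(t) = prod_q (1 - b_q + t)_(m_q + j) / prod_h (t - a_h)_(n_h + j + 1)
>>
    (lemma [prefactor_term]).  As the a_h are distinct modulo integers, the
    poles that the denominator produces are simple, and they are exactly the
    points a_i - k with 0 <= k <= j + n_i.

    Suppose that m_q + j >= 0 for all q, that is, j > - m_min - 1.  Then the
    numerator of f_j is a polynomial, so the coefficient of z^j is the sum of
    all the residues of f_j.  This sum vanishes as soon as the degree of the
    numerator is at most that of the denominator minus 2, i.e.
    M + s j + 2 <= N + r j + r, which is the same as j > p.  Hence the
    coefficients with j > max(- m_min - 1, p) are zero; those with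
    j < - n_max are empty sums.

    The vanishing of the sum of residues is Lagrange interpolation: the leading
    coefficient of the polynomial that interpolates P at d nodes is
    sum_x P(x) / prod_(y <> x) (x - y), and it is zero if deg P <= d - 2
    ([sum_simple_residues_eq0], [sum_residues_eq0], [laurent_coef_high]).

    For the analysis, the ratio of consecutive terms of either series tends to
    0, so the terms are bounded by B / 8^k.  Such a bound gives convergence and
    makes the product of two partial sums differ from the partial sum of the
    Cauchy product by at most A B n^2 / 8^n ([cvg_cauchy_product]).  Two facts
    about the complex norm suffice for this: it is archimedean, and series
    dominated by a geometric one converge. *)

(** * Residues at simple poles *)

(** The sum is the coefficient of degree [size xs - 1] of the Lagrange
    interpolant of [p] at the nodes [xs], and this interpolant is [p]. *)
Lemma sum_simple_residues_eq0 (F : fieldType) (xs : seq F) (p : {poly F}) :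
  uniq xs -> (size p < size xs)%N ->
  \sum_(x <- xs) p.[x] / \prod_(y <- xs | y != x) (x - y) = 0.
Proof.
move=> Uxs szp.
pose L x := \prod_(y <- xs | y != x) ('X - y%:P).
have Lx x : (L x).[x] = \prod_(y <- xs | y != x) (x - y).
  by rewrite horner_prod; apply: eq_bigr => y _; rewrite !hornerE.
have Lx_neq0 x : (L x).[x] != 0.
  rewrite Lx prodf_seq_neq0; apply/allP => y _; apply/implyP => yx.
  by rewrite subr_eq0 eq_sym.
have Ly x y : y \in xs -> y != x -> (L x).[y] = 0.
  by move=> yxs yx; rewrite /L (big_rem y) //= yx !hornerE subrr mul0r.
have szL x : x \in xs -> size (L x) = size xs.
  move=> xxs; rewrite /L -big_filter size_prod_XsubC.
  rewrite size_filter -(count_predC (pred1 x) xs) count_uniq_mem // xxs.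
  by [].
have mL x : L x \is monic by apply: monic_prod => y _; apply: monicXsubC.
pose q := \sum_(x <- xs) (p.[x] / (L x).[x]) *: L x.
have szq : (size q <= size xs)%N.
  rewrite /q big_seq.
  apply: (big_ind (fun u : {poly F} => size u <= size xs)%N).
  - by rewrite size_poly0.
  - by move=> u v su sv; rewrite (leq_trans (size_polyD _ _)) // geq_max su.
  - by move=> x xxs; rewrite (leq_trans (size_scale_leq _ _)) // szL.
have qx x : x \in xs -> q.[x] = p.[x].
  move=> xxs; rewrite /q horner_sum (bigD1_seq x) //= hornerZ divfK //.
  rewrite big1_seq ?addr0 // => y /andP[yx yxs].
  by rewrite hornerZ (Ly y x xxs) ?mulr0 // eq_sym.
have pq : p = q.
  apply/eqP; rewrite -subr_eq0; apply/eqP.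
  apply: (@roots_geq_poly_eq0 _ _ xs) => //.
    by apply/allP => x xxs; rewrite /root !hornerE qx // subrr.
  by rewrite (leq_trans (size_polyD _ _)) // size_polyN geq_max szq ltnW.
have : p`_(size xs).-1 = 0 by rewrite nth_default // -ltnS (ltn_predK szp).
rewrite {1}pq /q coef_sum => sum0; rewrite -[RHS]sum0.
apply: eq_big_seq => x xxs.
rewrite coefZ -Lx -(szL x xxs) -/(lead_coef _).
by rewrite (monicP (mL x)) mulr1.
Qed.

(** * Merging rising factorials *)

(** None of the factors x - 1, ..., x - |d| inverted by [rising x d] for
    negative d vanishes. *)
Definition rising_defined (C : numFieldType) (x : C) (d : int) :=
  forall k : int, 1 <= k <= - d -> x <> k%:~R.

Lemma rising0 (C : numFieldType) (x : C) : rising x 0 = 1.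
Proof. by rewrite -[0 : int]/(Posz 0) /rising big_geq. Qed.

Lemma risingS_r (C : numFieldType) (x : C) (d : int) :
  (d < 0 -> x + d%:~R != 0) -> rising x (d + 1) = rising x d * (x + d%:~R).
Proof.
case: d => n.
  move=> _; rewrite -PoszD addn1 /rising big_nat_recr //=.
move=> /(_ isT); rewrite NegzE => nz.
rewrite -NegzE [rising x (Negz n)]/= big_nat_recr //= invfM -mulrA.
have -> : x - n.+1%:R = x + (- n.+1%:Z)%:~R by rewrite rmorphN.
rewrite NegzE mulVf // mulr1.
case: n {nz} => [|n]; first by rewrite addNr rising0 big_geq ?invr1.
by have -> : - n.+2%:Z + 1 = Negz n by lia.
Qed.

Lemma risingS_l (C : numFieldType) (x : C) (d : int) :
  (d < 0 -> x != 0) -> rising x (d + 1) = x * rising (x + 1) d.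
Proof.
case: d => n.
  move=> _; rewrite -PoszD addn1 /rising big_nat_recl //= addr0.
  congr (_ * _); apply: eq_bigr => i _; rewrite -addrA; congr (_ + _).
  by rewrite -natr1 addrC.
move=> /(_ isT) nz.
rewrite [rising (x + 1) (Negz n)]/= big_nat_recl //= addrK invfM mulrA mulfV //.
rewrite mul1r.
case: n => [|n].
  by have -> : Negz 0 + 1 = 0 by []; rewrite rising0 big_geq ?invr1.
have -> : Negz n.+1 + 1 = Negz n by lia.
rewrite [LHS]/=; congr (_^-1); apply: eq_bigr => i _.
by rewrite -natr1 opprD addrACA subrr addr0.
Qed.

Lemma risingD_r (C : numFieldType) (x : C) (d : int) (l : nat) :
  rising_defined x d ->
  rising x (d + l%:Z) = rising x d * rising (x + d%:~R) l%:Z.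
Proof.
move=> xd; elim: l => [|l IHl]; first by rewrite addr0 rising0 mulr1.
have -> : l.+1%:Z = l%:Z + 1 by lia.
rewrite addrA [LHS]risingS_r; last first.
  move=> dl; apply/eqP => xdl; apply: (xd (- (d + l%:Z))); first by lia.
  by apply/eqP; rewrite -subr_eq0 rmorphN opprK xdl.
by rewrite risingS_r // IHl -mulrA rmorphD /= addrA.
Qed.

Lemma risingD_l (C : numFieldType) (x : C) (e : int) (k : nat) :
  rising_defined x e ->
  rising (x - k%:R) (e + k%:Z) = rising (x - k%:R) k%:Z * rising x e.
Proof.
move=> xe; elim: k => [|k IHk]; first by rewrite subr0 addr0 rising0 mul1r.
have -> : k.+1%:Z = k%:Z + 1 by lia.
have xk : x - k.+1%:R + 1 = x - k%:R by rewrite -natr1 opprD addrA subrK.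
rewrite addrA [LHS]risingS_l; last first.
  move=> ek; apply/eqP => xk0; apply: (xe k.+1%:Z); first by lia.
  by apply/eqP; rewrite -subr_eq0 xk0.
by rewrite risingS_l // xk IHk mulrA.
Qed.

Lemma rising_reflect (C : numFieldType) (x : C) (k : nat) :
  rising (1 - x) k%:Z = (-1) ^+ k * rising (x - k%:R) k%:Z.
Proof.
elim: k x => [|k IHk] x; first by rewrite !rising0 mulr1.
have -> : k.+1%:Z = k%:Z + 1 by lia.
have xk : x - k.+1%:R + 1 = x - k%:R by rewrite -natr1 opprD addrA subrK.
rewrite risingS_r // risingS_l // xk IHk exprS -natr1 /=.
by rewrite -pmulrn; ring.
Qed.

Lemma rising_defined_shift (C : numFieldType) (x : C) (d : int) (l : nat) :
  rising_defined x d -> rising_defined x (d + l%:Z).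
Proof. by move=> xd k klt; apply: xd; lia. Qed.

(** Reversing (1 - x)_k gives (-1)^k (x - k)_k, so that (x)_d is extended by l
    factors on the right and by k factors on the left.  When d < 0 the first of
    these new factors cancel inverted factors of (x)_d, hence the only
    condition is that the latter be nonzero. *)
Lemma rising_merge (C : numFieldType) (x : C) (d : int) (k l : nat) :
  rising_defined x d ->
  rising (1 - x) k%:Z * (rising x d * rising (x + d%:~R) l%:Z) =
  (-1) ^+ k * rising (x - k%:R) (d + l%:Z + k%:Z).
Proof.
move=> xd; rewrite -risingD_r // rising_reflect -mulrA -risingD_l //.
exact: rising_defined_shift.
Qed.

(** * Residues of a quotient by rising factorials *)

(** As a function of t, 1 / (t - c)_f has for f >= 0 the f simple poles
    c, c - 1, ..., c - f + 1, and for f < 0 the zeros c + 1, ..., c + |f|;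
    [pole_count] and [zero_part] separate the two cases. *)
Definition pole_count (f : int) : nat := if f is Posz n then n else 0%N.

Definition zero_part (F : nzRingType) (c : F) (f : int) : {poly F} :=
  if f is Negz q then \prod_(1 <= j < q.+2) ('X - (c + j%:R)%:P) else 1.

Lemma inv_rising (C : numFieldType) (x c : C) (f : int) :
  (rising (x - c) f)^-1 =
  (zero_part c f).[x] / \prod_(0 <= k < pole_count f) (x - (c - k%:R)).
Proof.
case: f => n /=.
  rewrite hornerE mul1r; congr (_^-1); apply: eq_bigr => i _.
  by rewrite opprB addrCA addrC.
rewrite [X in _ / X]big_geq // divr1 invrK horner_prod; apply: eq_bigr => i _.
by rewrite !hornerE opprD addrA.
Qed.

Lemma zero_part_monic (F : nzRingType) (c : F) f : zero_part c f \is monic.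
Proof.
case: f => n; first exact: monic1.
by apply: monic_prod => j _; apply: monicXsubC.
Qed.

Lemma size_zero_part (F : nzRingType) (c : F) (f : int) :
  (size (zero_part c f))%:Z = (pole_count f).+1%:Z - f.
Proof.
case: f => n; first by rewrite size_poly1 /=; lia.
rewrite /zero_part size_prod_XsubC size_iota /=; lia.
Qed.

(** The derivative at t = c - k of the product of the k + l + 1 factors
    t - c + j, which is the contribution to a residue of the poles in the same
    class modulo integers. *)
Lemma prod_index_gap (C : numFieldType) (k l : nat) :
  \prod_(0 <= j < (k + l).+1 | j != k) (j%:R - k%:R : C) =
  (-1) ^+ k * k`!%:R * l`!%:R.
Proof.
rewrite (@big_cat_nat _ _ _ k) //=; last by rewrite ltnW // ltnS leq_addr.
rewrite [X in _ * X]big_ltn_cond ?ltnS ?leq_addr // eqxx /=.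
congr (_ * _).
  rewrite big_nat_cond (eq_bigl (fun j => (0 <= j < k)%N && true)); last first.
    by move=> j; case: (ltngtP j k); rewrite ?andbF.
  rewrite -big_nat_cond big_nat_rev /= add0n fact_prod natr_prod.
  rewrite [in RHS]big_add1 /= -[X in _ ^+ X]subn0 -prodr_const_nat.
  rewrite -big_split /=.
  apply: eq_big_nat => j /andP[_ jk]; rewrite natrB ?subSS //.
  by rewrite -addn1 natrD mulN1r; ring.
have -> : (k + l).+1 = (l + k.+1)%N by lia.
rewrite -{1}[k.+1]add0n big_addn addnK fact_prod natr_prod [in RHS]big_add1 /=.
rewrite (eq_bigl xpredT); last by move=> j; lia.
by apply: eq_bigr => j _; rewrite natrD -natr1 -[j.+1%:R]natr1; ring.
Qed.

(** The rational function is p(t) / prod_h (t - a_h)_(f_h), whose numerator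
    after reduction is [p] times the zero parts of the factors with f_h < 0.
    The degree of the denominator minus that of the zero parts is sum_h f_h, so
    the hypothesis on [size p] says that the degree drops by at least 2. *)
Lemma sum_residues_eq0 (C : numFieldType) (r : nat) (a : 'I_r -> C)
    (f : 'I_r -> int) (p : {poly C}) :
  (forall i h : 'I_r, i != h -> forall k : int, a i - a h <> k%:~R) ->
  p != 0 -> (size p)%:Z + 1 <= \sum_(h < r) f h ->
  \sum_(i < r) \sum_(0 <= k < pole_count (f i))
     p.[a i - k%:R] / \prod_(h < r | h != i) rising (a i - k%:R - a h) (f h)
     / ((-1) ^+ k * k`!%:R * (pole_count (f i) - k.+1)`!%:R) = 0.
Proof.
move=> aZ p0 szp.
(* The poles; they are distinct because the a_h are so modulo integers. *)
pose ns := [seq a h - k%:R | h <- enum 'I_r, k <- iota 0 (pole_count (f h))].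
have sep (i h : 'I_r) (k l : nat) : i != h -> a i - k%:R != a h - l%:R.
  move=> /aZ ih; apply/eqP => e; apply: (ih (k%:Z - l%:Z)).
  by rewrite rmorphB /= -[a i](subrK k%:R) e; ring.
have Uns : uniq ns.
  apply: allpairs_uniq_dep.
  - exact: enum_uniq.
  - by move=> h _; apply: iota_uniq.
  move=> [i k] [h l] _ _ /= e.
  have ih : i = h.
    apply/eqP; apply: contraT => ih.
    by have := sep _ _ k l ih; rewrite e eqxx.
  move: e; rewrite ih => /addrI/oppr_inj/eqP; rewrite eqr_nat => /eqP ->.
  by [].
have iotaE l : iota 0 l = index_iota 0 l by rewrite /index_iota subn0.
have szns : (size ns)%:Z = \sum_(h < r) (pole_count (f h))%:Z.
  rewrite size_allpairs_dep sumnE big_map big_enum /=.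
  rewrite (big_morph Posz PoszD (erefl _)); apply: eq_bigr => h _.
  by rewrite size_iota.
pose Z := \prod_(h < r) zero_part (a h) (f h).
pose P := p * Z.
have szP : (size P < size ns)%N.
  have mz : Z \is monic.
    by apply: monic_prod => h _; apply: zero_part_monic.
  have szz : (size Z)%:Z =
             1 + (size ns)%:Z - \sum_(h < r) f h.
    rewrite /Z size_prod => [|h _]; last exact/monic_neq0/zero_part_monic.
    have sumz : (\sum_(h < r) size (zero_part (a h) (f h)))%:Z =
                (size ns)%:Z + r%:Z - \sum_(h < r) f h.
      rewrite (big_morph Posz PoszD (erefl _)) szns.
      rewrite (eq_bigr (fun h => (pole_count (f h))%:Z + 1 - f h)); last first.
        by move=> h _; rewrite size_zero_part; lia.
      rewrite !sumrB big_split /= sumr_const card_ord.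
      by rewrite natz.
    have rS : (r <= \sum_(h < r) size (zero_part (a h) (f h)))%N.
      rewrite -[X in (X <= _)%N](card_ord r) -sum1_card; apply: leq_sum => h _.
      by rewrite size_poly_gt0; apply/monic_neq0/zero_part_monic.
    rewrite cardE size_enum_ord.
    move: sumz rS; set S := (\sum_(h < r) size _)%N; set T := \sum_(h < r) f h.
    set L := size ns.
    lia.
  rewrite /P size_Mmonic //.
  move: szz szp; set S := size Z; set T := \sum_(h < r) f h.
  have := p0; rewrite -size_poly_gt0; set L := size ns; set Q := size p.
  lia.
rewrite -[RHS](sum_simple_residues_eq0 Uns szP).
rewrite big_allpairs_dep big_enum /=; apply: eq_bigr => i _.
rewrite iotaE.
apply: eq_big_nat => k /andP[_ kf].
set x := a i - k%:R.
have -> : P.[x] = p.[x] * \prod_(h < r | h != i) (zero_part (a h) (f h)).[x].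
  rewrite /P /Z hornerM horner_prod (bigD1 i) //=; congr (_ * _).
  by case: (f i) kf => //= q _; rewrite hornerE mul1r.
have -> : \prod_(y <- ns | y != x) (x - y) =
  \prod_(h < r | h != i) \prod_(0 <= l < pole_count (f h)) (x - (a h - l%:R)) *
  ((-1) ^+ k * k`!%:R * (pole_count (f i) - k.+1)`!%:R).
  rewrite big_mkcond big_allpairs_dep big_enum /= (bigD1 i) //= mulrC.
  congr (_ * _).
    apply: eq_bigr => h hi; rewrite iotaE.
    by apply: eq_bigr => l _; rewrite sep.
  rewrite iotaE -big_mkcond /=.
  rewrite -prod_index_gap.
  have -> : (k + (pole_count (f i) - k.+1)).+1 = pole_count (f i) by lia.
  apply: eq_big => l.
    by rewrite /x (inj_eq (addrI _)) (inj_eq oppr_inj) eqr_nat.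
  by move=> _; rewrite /x; ring.
move: ((-1) ^+ k * _ * _) => g; rewrite invfM mulrA; congr (_ / _).
rewrite -mulrA; congr (_ * _).
rewrite -prodfV [in RHS]mulrC -prodfV -big_split /=.
by apply: eq_bigr => h _; rewrite inv_rising mulrC.
Qed.

(** * The coefficients of the Laurent expansion *)

Lemma rising_vec_merge (C : numFieldType) (s : nat) (x : 'I_s -> C)
    (d : 'I_s -> int) (k l : nat) :
  (forall i, rising_defined (x i) (d i)) ->
  rising_vec (fun i => 1 - x i) (fun=> k%:Z) *
    (rising_vec x d * rising_vec (fun i => x i + (d i)%:~R) (fun=> l%:Z)) =
  ((-1) ^+ k) ^+ s *
    rising_vec (fun i => x i - k%:R) (fun i => d i + l%:Z + k%:Z).
Proof.
move=> xd; rewrite /rising_vec -2!big_split /=.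
rewrite -[X in _ ^+ X](card_ord s) -prodr_const -big_split /=.
by apply: eq_bigr => i _; apply: rising_merge.
Qed.

Lemma rising_vec_omit (C : numFieldType) (r : nat) (i : 'I_r) (c : 'I_r -> C)
    (k : 'I_r -> int) :
  rising_vec (omit i c) (omit i k) = \prod_(h < r | h != i) rising (c h) (k h).
Proof.
rewrite [RHS]big_mkcond (bigD1_ord i) //= eqxx mul1r.
by apply: eq_bigr => l _; rewrite eq_sym neq_lift.
Qed.

Definition prefactor (C : numFieldType) (r s : nat) (a : 'I_r -> C)
    (b : 'I_s -> C) (m : 'I_s -> int) (n : 'I_r -> int) (i : 'I_r) : C :=
  rising_vec (fun l => 1 - b l + a i) (fun l => m l - n i)
  / ((-1) ^ ((s%:Z - r%:Z) * n i)
     * rising_vec (fun l => a i - omit i a l)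
                  (fun l => omit i n l - n i + 1)).

Definition left_term (C : numFieldType) (r s : nat) (a : 'I_r -> C)
    (b : 'I_s -> C) (i : 'I_r) (z : C) : nat -> C :=
  hyp_term (fun l => b l - a i) (fun l => 1 + omit i a l - a i) z.

Definition right_term (C : numFieldType) (r s : nat) (a : 'I_r -> C)
    (b : 'I_s -> C) (m : 'I_s -> int) (n : 'I_r -> int) (i : 'I_r) (z : C) :
    nat -> C :=
  hyp_term (fun l => 1 - b l + a i + (m l - n i)%:~R)
    (fun l => 1 - omit i a l + a i + (omit i n l - n i)%:~R)
    ((-1) ^ (r%:Z - s%:Z) * z).

Lemma signz_eq (C : numFieldType) (x y q : int) :
  x = y + 2 * q -> (-1) ^ x = (-1) ^ y :> C.
Proof.
move=> ->; rewrite expfzDr ?oppr_eq0 ?oner_eq0 // -exprz_exp.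
by rewrite -[(-1) ^ 2]/((-1) ^+ 2) sqrrN expr1n exp1rz mulr1.
Qed.

(** Up to the sign (-1)^((r-s) j), the right-hand side is the residue of f_j at
    a_i - k: the factor h = i of the denominator has its simple pole there and
    contributes (-1)^k k! l!, where k! and l! are those of the two series.  The
    signs (-1)^k of the s upper and r - 1 lower merged factors, the sign in the
    prefactor and that of the argument (-1)^(r-s) z of the second series
    combine to (-1)^((r-s) j) (-1)^k. *)
Lemma prefactor_term (C : numFieldType) (r s : nat) (a : 'I_r -> C)
    (b : 'I_s -> C) (m : 'I_s -> int) (n : 'I_r -> int) (i : 'I_r) (j : int)
    (k l : nat) :
  (0 < r)%N ->
  (forall i h : 'I_r, i != h -> forall k : int, a i - a h <> k%:~R) ->
  (forall q : 'I_s, rising_defined (1 - b q + a i) (m q - n i)) ->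
  k%:Z + l%:Z = j + n i ->
  prefactor a b m n i * (left_term a b i 1 k * right_term a b m n i 1 l) =
  (-1) ^ ((r%:Z - s%:Z) * j) *
  (\prod_(q < s) rising (1 - b q + a i - k%:R) (m q + j)
   / \prod_(h < r | h != i) rising (a i - k%:R - a h) (n h + j + 1)
   / ((-1) ^+ k * k`!%:R * l`!%:R)).
Proof.
move=> r0 aZ bdef kl.
have num := rising_vec_merge k l bdef.
(* For h <> i, the lower parameters merge with the denominator of the
   prefactor, with x = a_i - a_h and d = n_h - n_i + 1. *)
have den := @rising_vec_merge C r.-1 (fun h => a i - omit i a h)
  (fun h => omit i n h - n i + 1) k l.
have {}den := den (fun h q _ => aZ _ _ (neq_lift i h) q).
rewrite (_ : (fun q => 1 - (1 - b q + a i)) = fun q => b q - a i) in num;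
  last by apply/funext => q; ring.
rewrite (_ : (fun h => 1 - (a i - omit i a h)) =
             fun h => 1 + omit i a h - a i) in den;
  last by apply/funext => h; ring.
rewrite (_ : (fun h => a i - omit i a h + (omit i n h - n i + 1)%:~R) =
             fun h => 1 - omit i a h + a i + (omit i n h - n i)%:~R) in den;
  last by apply/funext => h; rewrite rmorphD /=; ring.
have numE : rising_vec (fun q => 1 - b q + a i - k%:R)
    (fun q => m q - n i + l%:Z + k%:Z) =
  \prod_(q < s) rising (1 - b q + a i - k%:R) (m q + j).
  by apply: eq_bigr => q _; congr rising; lia.
have denE : rising_vec (fun h => a i - omit i a h - k%:R)
    (fun h => omit i n h - n i + 1 + l%:Z + k%:Z) =
  \prod_(h < r | h != i) rising (a i - k%:R - a h) (n h + j + 1).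
  rewrite -(@rising_vec_omit _ _ _ (fun h => a i - k%:R - a h)
            (fun h => n h + j + 1)).
  apply: eq_bigr => h _; congr rising; first by rewrite addrAC.
  by rewrite /omit; lia.
rewrite numE in num; rewrite denE in den.
rewrite /prefactor /left_term /right_term /hyp_term mulr1 expr1n.
move: num den.
set N := \prod_(q < s) _; set D := \prod_(h < r | _) _.
set X := rising_vec _ (fun q => m q - n i).
set Y := rising_vec _ (fun h => omit i n h - n i + 1).
move: (rising_vec (fun l => b l - a i) _) => c1.
move: (rising_vec (fun l => 1 + omit i a l - a i) _) => d1.
move: (rising_vec _ (fun=> l%:Z)) => c2.
move: (rising_vec _ (fun=> l%:Z)) => d2.
set E := (-1) ^ _; set e := (-1) ^ (r%:Z - s%:Z).
move=> num den.
have sgn : ((-1) ^+ k) ^+ s / ((-1) ^+ k) ^+ r.-1 * (e ^+ l / E) =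
           (-1) ^ ((r%:Z - s%:Z) * j) / (-1) ^+ k :> C.
  have rE : r.-1%:Z = r%:Z - 1 by lia.
  have lE : l%:Z = j + n i - k%:Z by lia.
  rewrite /E /e !exprnP !exprz_exp !invr_expz -!expfzDr ?oppr_eq0 ?oner_eq0 //.
  apply: (@signz_eq _ _ _ (k%:Z * s%:Z - k%:Z * r%:Z + k%:Z
    + (r%:Z - s%:Z) * n i)).
  by rewrite rE lE; ring.
have -> : X / (E * Y) * (c1 / d1 * (1 / k`!%:R) * (c2 / d2 * (e ^+ l / l`!%:R)))
  = (c1 * (X * c2)) / (d1 * (Y * d2)) * (e ^+ l / E) / (k`!%:R * l`!%:R).
  by rewrite !invfM; ring.
rewrite num den.
have -> : ((-1) ^+ k) ^+ s * N / (((-1) ^+ k) ^+ r.-1 * D) * (e ^+ l / E) =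
  N / D * (((-1) ^+ k) ^+ s / ((-1) ^+ k) ^+ r.-1 * (e ^+ l / E)).
  by rewrite invfM; ring.
by rewrite sgn !invfM; ring.
Qed.

(** In the i-th summand the power series is multiplied by z^(-n_i), so z^j
    comes from the terms of total degree j + n_i, of which there are none when
    this number is negative.  The series are evaluated at z = 1 to extract
    their coefficients. *)
Definition laurent_coef (C : numFieldType) (r s : nat) (a : 'I_r -> C)
    (b : 'I_s -> C) (m : 'I_s -> int) (n : 'I_r -> int) (j : int) : C :=
  \sum_(i < r) prefactor a b m n i *
    (if j + n i is Posz t then
       \sum_(0 <= k < t.+1) left_term a b i 1 k * right_term a b m n i 1 (t - k)
     else 0).

(** The coefficient is a multiple of the sum of the residues of f_j at the
    poles of 1 / prod_h (t - a_h)_(n_h + j + 1).  As m_q + j >= 0, its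
    numerator has no poles, so [sum_residues_eq0] applies; the last hypothesis
    is the drop of the degree by 2. *)
Lemma laurent_coef_high (C : numFieldType) (r s : nat) (a : 'I_r -> C)
    (b : 'I_s -> C) (m : 'I_s -> int) (n : 'I_r -> int) (j : int) :
  (0 < r)%N ->
  (forall i h : 'I_r, i != h -> forall k : int, a i - a h <> k%:~R) ->
  (forall i q, rising_defined (1 - b q + a i) (m q - n i)) ->
  (forall q, 0 <= m q + j) ->
  \sum_(q < s) (m q + j) + 2 <= \sum_(h < r) (n h + j + 1) ->
  laurent_coef a b m n j = 0.
Proof.
move=> r0 aZ bdef mj deg.
pose p : {poly C} := \prod_(q < s) \prod_(t <- iota 0 (absz (m q + j)))
  ('X - (b q - 1 - t%:R)%:P).
have px x : p.[x] = \prod_(q < s) rising (x - (b q - 1)) (m q + j).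
  rewrite horner_prod; apply: eq_bigr => q _.
  rewrite -[in RHS](gez0_abs (mj q)) horner_prod /rising /index_iota subn0.
  apply: eq_bigr => t _.
  by rewrite !hornerE; ring.
have mp : p \is monic.
  by apply: monic_prod => q _; apply: monic_prod => t _; apply: monicXsubC.
have szp : (size p)%:Z = 1 + \sum_(q < s) (m q + j).
  rewrite size_prod; last first.
    by move=> q _; apply/monic_neq0/monic_prod => t _; apply: monicXsubC.
  rewrite (eq_bigr (fun q => addn (absz (m q + j)) 1)); last first.
    by move=> q _; rewrite size_prod_XsubC size_iota addn1.
  rewrite big_split /= sum_nat_const muln1 -addSn addnK.
  rewrite -add1n PoszD; congr (_ + _).
  rewrite (big_morph Posz PoszD (erefl _)); apply: eq_bigr => q _.
  exact: gez0_abs.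
have szp1 : (size p)%:Z + 1 <= \sum_(h < r) (n h + j + 1).
  by rewrite szp addrAC addrC; exact: deg.
rewrite -[RHS](mulr0 ((-1) ^ ((r%:Z - s%:Z) * j))).
rewrite -[in RHS](sum_residues_eq0 aZ (monic_neq0 mp) szp1).
rewrite mulr_sumr; apply: eq_bigr => i _.
have -> : n i + j + 1 = (j + n i) + 1 by lia.
case E : (j + n i) => [t|t]; last first.
  rewrite mulr0 [X in _ * X]big1_seq ?mulr0 // => k.
  by rewrite mem_index_iota; case: t {E}.
have -> : t%:Z + 1 = t.+1 by lia.
rewrite /= !mulr_sumr; apply: eq_big_nat => k /andP[_ kt].
rewrite (@prefactor_term _ _ _ _ _ _ _ _ j) //; last by rewrite E; lia.
rewrite subSS px; congr (_ * (_ / _ / _)).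
by apply: eq_bigr => q _; congr rising; ring.
Qed.

(** * Entire hypergeometric series and their products *)

Local Open Scope classical_set_scope.

(** The analysis is carried out over any [numFieldType] with the next two
    properties, with its canonical topology, which is the one that [hypF] uses.
    The rate 1/8 leaves room for the n^2 <= 4^n terms that are estimated in
    [cvg_cauchy_product]. *)
Definition archimedean_norm (C : numFieldType) : Prop :=
  forall x : C, exists n : nat, `|x| <= n%:R.

Definition geometrically_complete (C : numFieldType) : Prop :=
  forall (u : nat -> C) (B : C),
    (forall k, `|u k| <= B / 8 ^+ k) -> cvgn (series u).

Lemma near_norm_le (C : numFieldType) (x : C) :
  archimedean_norm C -> \forall n \near \oo, `|x| <= n%:R.
Proof.
move=> /(_ x)[N xN]; exists N => // n /= Nn.
by rewrite (le_trans xN) // ler_nat.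
Qed.

Lemma dominated_ge0 (C : numFieldType) (u : nat -> C) (B c : C) :
  (forall k, `|u k| <= B / c ^+ k) -> 0 <= B.
Proof. by move=> /(_ 0%N); rewrite expr0 divr1; apply: le_trans. Qed.

Lemma cvg0_geometric (C : numFieldType) (u : nat -> C) (B : C) :
  archimedean_norm C -> (forall n, `|u n| <= B / 2 ^+ n) -> u @ \oo --> (0 : C).
Proof.
move=> arch uB; apply/cvgr0Pnorm_le => eps eps0.
have B0 := dominated_ge0 uB.
near=> n; rewrite (le_trans (uB n)) // ler_pdivrMr ?exprn_gt0 //.
rewrite mulrC -ler_pdivrMr // (@le_trans _ _ n%:R) //.
  rewrite -[leLHS]ger0_norm ?divr_ge0 ?(ltW eps0) //.
  by near: n; apply: near_norm_le.
by rewrite -natrX ler_nat ltnW // ltn_expl.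
Unshelve. all: by end_near. Qed.

Lemma hyp_termS (C : numFieldType) (s q : nat) (c : 'I_s -> C) (d : 'I_q -> C)
    (z : C) (k : nat) :
  hyp_term c d z k.+1 = hyp_term c d z k *
    (\prod_(l < s) (c l + k%:R) / \prod_(l < q) (d l + k%:R) * (z / k.+1%:R)).
Proof.
have E p (x : 'I_p -> C) : rising_vec x (fun=> k.+1%:Z) =
    rising_vec x (fun=> k%:Z) * \prod_(l < p) (x l + k%:R).
  rewrite /rising_vec -big_split /=; apply: eq_bigr => l _.
  by rewrite big_nat_recr.
rewrite /hyp_term !E exprSr factS mulnC natrM !invfM; ring.
Qed.

(** Once k >= |c_l| and k >= 2 |d_l|, one has |c_l + k| <= 2 k and
    |d_l + k| >= k / 2; with s <= q the powers of k cancel, and the factor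
    z / (k + 1) is as small as required. *)
Lemma ratio_bound (C : numFieldType) (s q : nat) (c : 'I_s -> C)
    (d : 'I_q -> C) (z : C) (k : nat) :
  (s <= q)%N -> (0 < k)%N ->
  (forall l, `|c l| <= k%:R) -> (forall l, `|2 * d l| <= k%:R) ->
  `|8 * 2 ^+ (s + q) * z| <= k%:R ->
  `|\prod_(l < s) (c l + k%:R) / \prod_(l < q) (d l + k%:R) * (z / k.+1%:R)|
    <= 8^-1.
Proof.
move=> sq k0 ck dk zk.
have k0C : 0 < k%:R :> C by rewrite ltr0n.
have up : `|\prod_(l < s) (c l + k%:R)| <= (2 * k%:R) ^+ s.
  rewrite normr_prod -[X in _ ^+ X](card_ord s) -prodr_const.
  apply: ler_prod => l _; rewrite normr_ge0 /= (le_trans (ler_normD _ _)) //.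
  by rewrite normr_nat mulr_natl mulr2n lerD.
have lo : (k%:R / 2) ^+ q <= `|\prod_(l < q) (d l + k%:R)|.
  rewrite normr_prod -[X in _ ^+ X](card_ord q) -prodr_const.
  apply: ler_prod => l _; rewrite divr_ge0 ?ler0n //=.
  have := ler_normB (d l + k%:R) (d l); rewrite addrAC subrr add0r normr_nat.
  have := dk l; rewrite normrM normr_nat => dk2 kd.
  rewrite -(lerD2r `|d l|) (le_trans _ kd) // [leRHS]splitr lerD2l.
  by rewrite ler_pdivlMr // mulrC.
rewrite !normrM !normfV normr_nat.
have quot : `|\prod_(l < s) (c l + k%:R)| / `|\prod_(l < q) (d l + k%:R)|
    <= 2 ^+ (s + q).
  have pos : 0 < (k%:R / 2 : C) ^+ q by rewrite exprn_gt0 // divr_gt0.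
  rewrite ler_pdivrMr ?(lt_le_trans pos) // (le_trans up) //.
  apply: le_trans (ler_wpM2l _ lo); last by rewrite exprn_ge0.
  rewrite exprD -mulrA -[2 ^+ q * _]exprMn [2 * (_ / _)]mulrC.
  rewrite divfK ?pnatr_eq0 // exprMn.
  by rewrite ler_wpM2l ?exprn_ge0 // ler_weXn2l // ler1n.
rewrite (le_trans (ler_wpM2r _ quot)) ?divr_ge0 //.
rewrite mulrA ler_pdivrMr // -[leRHS]mul1r mulrCA ler_pdivlMl // mulrA mul1r.
move: zk; rewrite !normrM normr_nat normrX normr_nat => /le_trans; apply.
by rewrite ler_nat.
Qed.

(** The weighted terms |u_k| 8^k decrease from some index K on, so the sum of
    the first K + 1 of them bounds them all. *)
Lemma hyp_term_bound (C : numFieldType) (s q : nat) (c : 'I_s -> C)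
    (d : 'I_q -> C) (z : C) :
  archimedean_norm C -> (s <= q)%N ->
  exists B : C, forall k, `|hyp_term c d z k| <= B / 8 ^+ k.
Proof.
move=> arch sq.
have : \forall k \near \oo, [/\ (0 < k)%N, forall l, `|c l| <= k%:R,
    forall l, `|2 * d l| <= k%:R & `|8 * 2 ^+ (s + q) * z| <= k%:R].
  near=> k; split; near: k.
  - by exists 1%N.
  - by apply: filter_forall => l; apply: near_norm_le.
  - by apply: filter_forall => l; apply: near_norm_le.
  - exact: near_norm_le.
move=> [K _ KP].
pose w k := `|hyp_term c d z k| * 8 ^+ k.
have w0 k : 0 <= w k by rewrite mulr_ge0 ?exprn_ge0.
have wS k : (K <= k)%N -> w k.+1 <= w k.
  move=> /KP /= [k0 ck dk zk].
  rewrite /w hyp_termS normrM exprS -[leLHS]mulrA ler_wpM2l // mulrA.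
  by rewrite ler_piMl ?exprn_ge0 // -ler_pdivlMr // div1r ratio_bound.
exists (\sum_(i < K.+1) w i) => k; rewrite ler_pdivlMr ?exprn_gt0 // -/(w k).
elim: k => [|k IHk].
  by rewrite big_ord_recl lerDl sumr_ge0.
have [Kk|kK] := leqP K k; first exact: le_trans (wS _ Kk) IHk.
by rewrite (bigD1 (Ordinal (kK : k.+1 < K.+1)%N)) //= lerDl sumr_ge0.
Unshelve. all: by end_near. Qed.

(** The product of the partial sums runs over the square k, j < n and the
    partial sum of the Cauchy product over the triangle k + j < n. *)
Lemma cauchy_partial_sums (C : numFieldType) (u v : nat -> C) (n : nat) :
  series u n * series v n -
    series (fun t => \sum_(0 <= k < t.+1) u k * v (t - k)%N) n =
  \sum_(0 <= k < n) u k * \sum_(n - k <= j < n) v j.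
Proof.
rewrite /series /=.
have -> : \sum_(0 <= t < n) \sum_(0 <= k < t.+1) u k * v (t - k)%N =
          \sum_(0 <= k < n) u k * \sum_(0 <= j < n - k) v j.
  rewrite big_nat_cond.
  under eq_bigr => t /andP[/andP[_ tn] _] do
    rewrite (@big_nat_widen _ _ _ 0 t.+1 n) //.
  rewrite -big_nat_cond (exchange_big_dep_nat xpredT) //=.
  apply: eq_big_nat => k /andP[_ kn]; rewrite mulr_sumr.
  rewrite -(big_nat_widenl k 0 n xpredT (fun t => u k * v (t - k)%N)) //.
  by rewrite -{1}[k]add0n big_addn; apply: eq_bigr => j _; rewrite addnK.
rewrite mulr_suml -sumrB; apply: eq_big_nat => k /andP[_ kn].
rewrite -mulrBr; congr (_ * _).
by rewrite (@big_cat_nat _ _ _ (n - k) 0 n) //= ?leq_subr // addrAC subrr add0r.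
Qed.

(** The difference in [cauchy_partial_sums] has at most n^2 <= 4^n terms, each
    at most A B / 8^n. *)
Lemma cvg_cauchy_product (C : numFieldType) (u v : nat -> C) (A B x y : C) :
  archimedean_norm C ->
  (forall k, `|u k| <= A / 8 ^+ k) -> (forall k, `|v k| <= B / 8 ^+ k) ->
  series u @ \oo --> x -> series v @ \oo --> y ->
  series (fun t => \sum_(0 <= k < t.+1) u k * v (t - k)%N) @ \oo --> x * y.
Proof.
move=> arch uA vB ux vy.
have A0 := dominated_ge0 uA.
have B0 := dominated_ge0 vB.
set w := series _.
have diff0 : series u \* series v - w @ \oo --> (0 : C).
  apply: (@cvg0_geometric _ _ (A * B)) => // n.
  rewrite [X in `|X|]cauchy_partial_sums.
  have term k j : (n - k <= j)%N -> `|u k * v j| <= A * B / 8 ^+ n.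
    move=> nkj; rewrite normrM (le_trans (ler_pM _ _ (uA k) (vB j))) //.
    rewrite mulrACA -invfM -exprD ler_wpM2l ?mulr_ge0 //.
    by rewrite lef_pV2 ?posrE ?exprn_gt0 // ler_weXn2l ?ler1n //; lia.
  have -> : A * B / 2 ^+ n = (A * B / 8 ^+ n) * (4 ^+ n).
    rewrite (_ : 8 = 4 * 2) -?natrM // natrM exprMn.
    by field; rewrite !expf_neq0.
  have row k : (k < n)%N ->
      `|u k * \sum_(n - k <= j < n) v j| <= A * B / 8 ^+ n * 2 ^+ n.
    move=> kn; rewrite mulr_sumr (le_trans (ler_norm_sum _ _ _)) //.
    apply: (@le_trans _ _ (\sum_(n - k <= j < n) A * B / 8 ^+ n)).
      by apply: ler_sum_nat => j /andP[nkj _]; apply: term.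
    rewrite sumr_const_nat subKn ?(ltnW kn) // -[leLHS]mulr_natr.
    rewrite ler_wpM2l ?divr_ge0 ?mulr_ge0 ?exprn_ge0 // -natrX ler_nat.
    by rewrite ltnW // (ltn_trans kn) // ltn_expl.
  rewrite (le_trans (ler_norm_sum _ _ _)) //.
  apply: (@le_trans _ _ (\sum_(0 <= k < n) A * B / 8 ^+ n * 2 ^+ n)).
    by apply: ler_sum_nat => k /andP[_ kn]; apply: row.
  rewrite sumr_const_nat subn0 -[leLHS]mulr_natr -mulrA.
  rewrite ler_wpM2l ?divr_ge0 ?mulr_ge0 ?exprn_ge0 //.
  rewrite (_ : 4 = 2 * 2) ?exprMn -?natrM // ler_wpM2l ?exprn_ge0 //.
  by rewrite -natrX ler_nat ltnW // ltn_expl.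
rewrite (_ : w = (series u \* series v) - (series u \* series v - w)).
  by rewrite -[x * y]subr0; apply: cvgB => //; apply: cvgM.
by apply/funext => n; rewrite /= opprB addrC subrK.
Qed.

(** * The complex numbers *)

Lemma complex_archimedean (R : realType) : archimedean_norm R[i].
Proof.
move=> x; rewrite normc_def; set y := Num.sqrt _.
have [N _ /(_ N (leqnn N)) yN] := nbhs_infty_ger y.
by exists N; rewrite -(rmorph_nat (real_complex R)) lecR.
Qed.

Lemma cvg_real_complex (R : realType) (f : nat -> R) (x : R) :
  f @ \oo --> x ->
  (real_complex R \o f : nat -> (R[i] : numFieldType)) @ \oo
    --> (real_complex R x : (R[i] : numFieldType)).
Proof.
move=> /cvgrPdist_le fx; apply/cvgrPdist_le => eps.
rewrite ltcE => /andP[/eqP/= im0 eps0].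
have -> : eps = real_complex R (complex.Re eps).
  by case: eps im0 {eps0} => ? ? /= ->.
near=> n.
rewrite [X in `|X|](_ : _ = real_complex R (x - f n)); last first.
  by rewrite rmorphB.
rewrite normc_def /= expr0n addr0 sqrtr_sqr lecR.
by near: n; apply: fx.
Unshelve. all: by end_near. Qed.

(** The series of real parts and of imaginary parts converge absolutely. *)
Lemma complex_geometrically_complete (R : realType) :
  geometrically_complete R[i].
Proof.
move=> u B uB.
have B0 := dominated_ge0 uB.
pose e k : R := complex.Re B / 8 ^+ k.
have eE k : B / 8 ^+ k = real_complex R (e k).
  rewrite /e rmorphM fmorphV rmorphXn /= (RRe_real (ger0_real B0)).
  by rewrite (rmorph_nat (real_complex R)).
have cvg_part (g : R[i] -> R) : (forall x, `|g x| <= complex.Re `|x|) ->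
    cvgn (series (g \o u)).
  move=> gx; apply: normed_cvg.
  apply: (@series_le_cvg _ _ e) => [k|k|k|].
  - exact: normr_ge0.
  - by rewrite divr_ge0 ?exprn_ge0 //; move: B0; rewrite lecE => /andP[].
  - apply: le_trans (gx _) _.
    by have := uB k; rewrite eE normc_def lecR.
  rewrite (_ : e = geometric (complex.Re B) 8^-1).
    by apply: is_cvg_geometric_series; rewrite ger0_norm ?invf_lt1 ?ltr1n.
  by apply/funext => k; rewrite /geometric /= exprVn.
have cRe : cvgn (series (@complex.Re R \o u)).
  apply: cvg_part => x; rewrite normc_def /= -sqrtr_sqr.
  rewrite ler_sqrt ?lerDl ?sqr_ge0 //.
  by rewrite addr_ge0 ?sqr_ge0.
have cIm : cvgn (series (@complex.Im R \o u)).
  apply: cvg_part => x; rewrite normc_def /= -sqrtr_sqr.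
  rewrite ler_sqrt ?lerDr ?sqr_ge0 //.
  by rewrite addr_ge0 ?sqr_ge0.
have hRe := cvg_real_complex cRe; have hIm := cvg_real_complex cIm.
pose I : (R[i] : numFieldType) := 'i%C.
have sE : series u = (real_complex R \o series (@complex.Re R \o u))
    \+ (cst I \* (real_complex R \o series (@complex.Im R \o u)))
    :> (nat -> (R[i] : numFieldType)).
  apply/funext => n; rewrite /series /= !rmorph_sum mulr_sumr -big_split /=.
  by apply: eq_bigr => k _; rewrite -complexE.
rewrite sE; apply: cvgP; apply: cvgD; first exact: hRe.
by apply: cvgM; [exact: cvg_cst | exact: hIm].
Qed.

(** * The range of the exponents *)

Lemma le_vec_max (r : nat) (n : 'I_r -> int) (i : 'I_r) :
  n i <= fine (vec_max n).
Proof.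
have ge : ((n i)%:E <= vec_max n)%E := le_bigmax _ (fun l => (n l)%:E) i.
have : vec_max n != +oo%E.
  by rewrite /vec_max; elim/big_ind: _ => // x y; case: leP.
by case: (vec_max n) ge => [x||] //; rewrite lee_fin.
Qed.

Lemma vec_min_neqNy (s : nat) (m : 'I_s -> int) : vec_min m != -oo%E.
Proof. by rewrite /vec_min; elim/big_ind: _ => // x y; case: leP. Qed.

Lemma le_upper_index (s : nat) (m : 'I_s -> int) (p : int) :
  p <= upper_index m p /\ forall l, - m l - 1 <= upper_index m p.
Proof.
have ge l : (vec_min m <= (m l)%:E)%E := bigmin_le _ l (fun l => (m l)%:E).
rewrite /upper_index; move: ge (vec_min_neqNy m).
case: (vec_min m) => [v ge _|ge _|//]; last first.
  by split=> [|l]; [rewrite /= maxNye | have := ge l].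
rewrite -EFinN -EFinD -EFin_max /=; split=> [|l].
  by rewrite le_max lexx orbT.
by rewrite le_max lerD2r lerN2 -lee_fin ge.
Qed.

(** The right-hand side is a partial sum of the Laurent series from [lo] on,
    which is constant once it has passed [hi]; this also covers hi < lo, when
    both sides are zero. *)
Lemma sum_int_range (V : nmodType) (lo hi : int) (g : int -> V) (K : nat) :
  (forall j, hi < j -> g j = 0) -> hi - lo + 1 <= K%:Z ->
  \sum_(j <- int_range lo hi) g j = \sum_(0 <= t < K) g (lo + t%:Z).
Proof.
move=> ghi hK.
have tail (L : nat) : (L <= K)%N -> hi < lo + L%:Z ->
    \sum_(0 <= t < K) g (lo + t%:Z) = \sum_(0 <= t < L) g (lo + t%:Z).
  move=> LK hL; rewrite (@big_cat_nat _ _ _ L) //= [X in _ + X]big_nat_cond.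
  rewrite [X in _ + X]big1 ?addr0 // => t /andP[/andP[Lt _] _].
  by apply: ghi; lia.
rewrite /int_range; case: ifP => [lohi|/negbT]; last first.
  by rewrite -ltNge => hilo; rewrite big_nil (tail 0%N) ?big_geq // addr0.
rewrite big_map (tail `|hi - lo|.+1) ?/index_iota ?subn0 //; lia.
Qed.

(** * The Laurent expansion *)

Lemma hyp_term_homog (C : numFieldType) (s q : nat) (c : 'I_s -> C)
    (d : 'I_q -> C) (e z : C) (k : nat) :
  hyp_term c d (e * z) k = hyp_term c d (e * 1) k * z ^+ k.
Proof. by rewrite /hyp_term mulr1 exprMn; ring. Qed.

Lemma left_term_homog (C : numFieldType) (r s : nat) (a : 'I_r -> C)
    (b : 'I_s -> C) (i : 'I_r) (z : C) (k : nat) :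
  left_term a b i z k = left_term a b i 1 k * z ^+ k.
Proof.
by rewrite /left_term -[z in LHS]mul1r hyp_term_homog mulr1.
Qed.

Lemma right_term_homog (C : numFieldType) (r s : nat) (a : 'I_r -> C)
    (b : 'I_s -> C) (m : 'I_s -> int) (n : 'I_r -> int) (i : 'I_r) (z : C)
    (k : nat) :
  right_term a b m n i z k = right_term a b m n i 1 k * z ^+ k.
Proof. exact: hyp_term_homog. Qed.

(** The i-th summand starts at z^(-n_i) rather than at z^lo, so the partial sum
    of length K takes only K - (- n_i - lo) terms of its Cauchy product. *)
Lemma laurent_partial_sum (C : numFieldType) (r s : nat) (a : 'I_r -> C)
    (b : 'I_s -> C) (m : 'I_s -> int) (n : 'I_r -> int) (z : C) (lo : int)
    (K : nat) :
  z != 0 -> (forall i, lo <= - n i) ->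
  \sum_(0 <= t < K) laurent_coef a b m n (lo + t%:Z) * z ^ (lo + t%:Z) =
  \sum_(i < r) prefactor a b m n i * z ^ (- n i) *
    series (fun t => \sum_(0 <= k < t.+1)
              left_term a b i z k * right_term a b m n i z (t - k)%N)
      (K - `|- n i - lo|)%N.
Proof.
move=> z0 lon; rewrite /laurent_coef.
under eq_bigr do rewrite mulr_suml.
rewrite exchange_big /=; apply: eq_bigr => i _.
set e := absz _; have eE : e%:Z = - n i - lo by rewrite gez0_abs // subr_ge0.
set H := (X in \sum_(0 <= t < K) X t = _).
have -> : \sum_(0 <= t < K) H t = \sum_(e <= t < K) H t.
  rewrite [RHS](big_nat_widenl e 0) // [RHS]big_mkcond /=.
  apply: eq_bigr => t _; case: leqP => // te; rewrite /H.
  have : lo + t%:Z + n i < 0 by lia.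
  by case: (lo + t%:Z + n i) => // q _; rewrite mulr0 mul0r.
rewrite -{1}[e]add0n big_addn /series /= mulr_sumr; apply: eq_bigr => t _.
have E : lo + (t + e)%:Z = - n i + t%:Z by rewrite PoszD eE; ring.
rewrite /H E addrAC addNr add0r expfzDr //= mulrACA.
congr (_ * _); rewrite mulr_suml.
apply: eq_big_nat => k /andP[_ kt].
rewrite [in RHS]left_term_homog [in RHS]right_term_homog.
have -> : z ^ t = z ^+ k * z ^+ (t - k)%N by rewrite -exprD subnKC.
ring.
Qed.

Lemma laurent_partial_sum_cvg (C : numFieldType) (r s : nat) (a : 'I_r -> C)
    (b : 'I_s -> C) (m : 'I_s -> int) (n : 'I_r -> int) (z : C) (lo : int) :
  archimedean_norm C -> geometrically_complete C -> (s <= r.-1)%N ->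
  z != 0 -> (forall i, lo <= - n i) ->
  (fun K => \sum_(0 <= t < K)
     laurent_coef a b m n (lo + t%:Z) * z ^ (lo + t%:Z)) @ \oo -->
  \sum_(i < r) prefactor a b m n i * z ^ (- n i) *
    (limn (series (left_term a b i z)) *
     limn (series (right_term a b m n i z))).
Proof.
move=> arch cpl sr z0 lon; under eq_fun do rewrite laurent_partial_sum //.
apply: cvg_big => [|i _]; first exact: add_continuous.
apply: cvgM; first exact: cvg_cst.
have [A uA] := hyp_term_bound (fun l => b l - a i)
  (fun l => 1 + omit i a l - a i) z arch sr.
have [B vB] := hyp_term_bound (fun l => 1 - b l + a i + (m l - n i)%:~R)
  (fun l => 1 - omit i a l + a i + (omit i n l - n i)%:~R)
  ((-1) ^ (r%:Z - s%:Z) * z) arch sr.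
apply: (cvg_comp _ _ (cvg_subnr (absz (- n i - lo)))).
apply: (cvg_cauchy_product arch uA vB); first exact: cpl uA.
exact: cpl vB.
Qed.

(** The partial sums of the Laurent series from z^lo on converge to the
    left-hand side, and they are constant once they have passed z^hi. *)
Lemma laurent_expansion (C : numFieldType) (r s : nat) (a : 'I_r -> C)
    (b : 'I_s -> C) (m : 'I_s -> int) (n : 'I_r -> int) (z : C) (lo hi : int) :
  archimedean_norm C -> geometrically_complete C -> (s <= r.-1)%N ->
  z != 0 -> (forall i, lo <= - n i) ->
  (forall j, hi < j -> laurent_coef a b m n j = 0) ->
  \sum_(i < r) prefactor a b m n i * z ^ (- n i) *
    (limn (series (left_term a b i z)) *
     limn (series (right_term a b m n i z))) =
  \sum_(j <- int_range lo hi) laurent_coef a b m n j * z ^ j.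
Proof.
move=> arch cpl sr z0 lon high.
apply: cvg_unique (laurent_partial_sum_cvg arch cpl sr z0 lon) _.
  exact: norm_hausdorff.
apply: cvg_near_cst; exists `|(hi - lo + 1)%R|%N => // K /= hK.
rewrite (@sum_int_range _ lo hi _ K) => // [j /high ->|]; last by lia.
by rewrite mul0r.
Qed.

Theorem theorem2 (R : realType) (r s : nat)
    (hr : (2 <= r)%N) (hs : (s <= r - 1)%N)
    (a : 'I_r -> R[i]) (b : 'I_s -> R[i])
    (m : 'I_s -> int) (n : 'I_r -> int)
    (ha : forall i j : 'I_r, i != j -> forall k : int, a i - a j <> k%:~R)
    (hdef : forall (i : 'I_r) (l : 'I_s), m l < n i ->
       forall k : int, 1 <= k <= n i - m l -> 1 - b l + a i <> k%:~R) :
  let M : int := \sum_(l < s) m l in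
  let N : int := \sum_(i < r) n i in
  let n_max : int := fine (vec_max n) in
  let p : int :=
    Num.floor ((M - N - r%:Z + 1)%:~R / (r%:Z - s%:Z)%:~R : rat) in
  exists beta : int -> R[i], forall z : R[i], z != 0 ->
    \sum_(i < r)
      rising_vec (fun l => 1 - b l + a i) (fun l => m l - n i) * z ^ (- n i)
      / ((-1) ^ ((s%:Z - r%:Z) * n i)
         * rising_vec (fun l => a i - omit i a l)
                      (fun l => omit i n l - n i + 1))
      * hypF (fun l => b l - a i) (fun l => 1 + omit i a l - a i) z
      * hypF (fun l => 1 - b l + a i + (m l - n i)%:~R)
             (fun l => 1 - omit i a l + a i + (omit i n l - n i)%:~R)
             ((-1) ^ (r%:Z - s%:Z) * z)
    = \sum_(j <- int_range (- n_max) (upper_index m p)) beta j * z ^ j.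
Proof.
move=> M N n_max p; exists (laurent_coef a b m n) => z z0.
have r0 : (0 < r)%N by exact: ltn_trans hr.
have bdef i q : rising_defined (1 - b q + a i) (m q - n i).
  by move=> k kmn; apply: hdef; lia.
have [p_up m_up] := le_upper_index m p.
set up := upper_index m p in p_up m_up *.
have high j : up < j -> laurent_coef a b m n j = 0.
  move=> upj; apply: laurent_coef_high => // [q|].
    by have := m_up q; lia.
  have rs0 : 0 < r%:Z - s%:Z by lia.
  have deg : M - N - r%:Z + 1 < j * (r%:Z - s%:Z).
    rewrite -(@ltr_int rat) rmorphM /= -ltr_pdivrMr ?ltr0z //.
    rewrite -floor_lt_int.
    exact: le_lt_trans p_up upj.
  rewrite !big_split /= !sumr_const !card_ord -/M -/N.
  rewrite !pmulrn !mulrzz.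
  lia.
have lon i : - n_max <= - n i by rewrite lerN2 le_vec_max.
have sr : (s <= r.-1)%N by rewrite -subn1.
rewrite -(@laurent_expansion R[i] r s a b m n z _ _
  (@complex_archimedean R) (@complex_geometrically_complete R) sr z0 lon high).
by apply: eq_bigr => i _; rewrite -[LHS]mulrA [_ * z ^ _ / _]mulrAC.
Qed.
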